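(* Let $c_1,c_2,c_3>0$ be constants and let $c_4\geq 10(c_1+c_2+c_3+1)$ be a constant. Let $k\geq1$ be an integer and let $A\in\mathbb{R}^{n\times n}$ have every entry bounded in absolute value by $n^{c_1}$. Define the block diagonal matrix $\widetilde{A}\in\mathbb{R}^{(n+k-1)\times(n+k-1)}$ whose first diagonal block is $A$ and whose remaining $k-1$ diagonal blocks are the $1\times1$ matrices $B=n^{c_4}$, all off-diagonal blocks being zero. If $\widehat{A}$ is a rank-$k$ matrix with $$\|\widehat{A}-\widetilde{A}\|_1\leq C\cdot\min_{\mathrm{rank}\text{-}k\ \widehat{A}'}\|\widehat{A}'-\widetilde{A}\|_1$$ for some $C\in[1,n^{c_3}]$, then there exists $j^*\in[n]$ such that $$\min_{v\in\mathbb{R}^n}\|\widehat{A}^{[1:n]}_{j^*}v^\top-A\|_1\leq C\cdot\min_{u,v\in\mathbb{R}^n}\|uv^\top-A\|_1+1/n^{c_2},$$ where $\widehat{A}^{[1:n]}_{j^*}\in\mathbb{R}^n$ denotes the first $n$ coordinates of the $j^*$-th column of $\widehat{A}$.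
   Context: $\|M\|_1=\sum_{i,j}|M_{i,j}|$ is the entrywise $\ell_1$ norm; the minimum on the first line is over all $(n+k-1)\times(n+k-1)$ matrices of rank at most $k$. *)

(* Defs.v *)
From HB Require Import structures.
From mathcomp Require Import all_boot all_order all_algebra.
From mathcomp Require Import all_classical all_reals all_analysis.
Set Implicit Arguments.
Unset Strict Implicit.
Unset Printing Implicit Defensive.
Import Order.TTheory GRing.Theory Num.Theory.
Import numFieldNormedType.Exports.
Local Open Scope classical_set_scope.
Local Open Scope ring_scope.

Definition l1norm (R : realType) (m n : nat) (M : 'M[R]_(m, n)) : R :=
  \sum_(i < m) \sum_(j < n) `|M i j|.

Definition is_minimum (R : realType) (S : set R) (x : R) : Prop :=
  S x /\ lbound S x.

(* The value is the junk 0 when S has no least element; the three minima at the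
   end of this file are shown to be attained. *)
Definition minimum (R : realType) (S : set R) : R := xget 0 (is_minimum S).

(* The k - 1 one-by-one diagonal blocks B are gathered in the scalar matrix
   B%:M of size k - 1. *)
Definition padded (R : realType) (n k : nat) (A : 'M[R]_n) (B : R) :
    'M[R]_(n + (k - 1)) :=
  block_mx A 0 0 B%:M.

Definition top_col (R : realType) (n p : nat) (M : 'M[R]_(n + p)) (j : 'I_n) :
    'cV[R]_n :=
  usubmx (col (lshift p j) M).

Section Attainment.
Variable R : realType.

Lemma minimumP (S : set R) : (exists x, is_minimum S x) ->
  is_minimum S (minimum S).
Proof. by move=> [x Sx]; exact: (xgetI 0 Sx). Qed.

Lemma minimum_eq (S : set R) (x : R) : is_minimum S x -> minimum S = x.
Proof.
move=> Sx; have [Sm lm] : is_minimum S (minimum S) by apply: minimumP; exists x.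
by case: Sx => Sx lx; apply/eqP; rewrite eq_le lm// lx.
Qed.

Section Rows.
Variables m n : nat.
Implicit Types (A M N : 'M[R]_(m, n)) (P : set 'M[R]_(m, n)).

Lemma l1norm_ge0 M : 0 <= l1norm M.
Proof. by apply: sumr_ge0 => i _; apply: sumr_ge0. Qed.

Lemma l1normD M N : l1norm (M + N) <= l1norm M + l1norm N.
Proof.
rewrite /l1norm -big_split; apply: ler_sum => i _.
by rewrite -big_split; apply: ler_sum => j _ /=; rewrite mxE ler_normD.
Qed.

Lemma ler_l1norm M i j : `|M i j| <= l1norm M.
Proof.
rewrite /l1norm (bigD1 i)//= (bigD1 j)//= -addrA lerDl addr_ge0 ?sumr_ge0//.
by move=> *; apply: sumr_ge0.
Qed.

Lemma vec_mx_coord_cont i j :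
  continuous (fun r : 'rV[R]_(m * n) => vec_mx r i j).
Proof.
rewrite (_ : (fun _ => _) = fun r : 'rV[R]_(m * n) => r ord0 (mxvec_index i j)).
  exact: coord_continuous.
by apply/funext => r; rewrite mxE.
Qed.

Lemma l1norm_cont A :
  continuous (fun r : 'rV[R]_(m * n) => l1norm (vec_mx r - A)).
Proof.
apply: continuous_big => [|i _]; first exact: add_continuous.
apply: continuous_big => [|j _] r; first exact: add_continuous.
have -> : (fun r => `|(vec_mx r - A) i j|) = (fun r => `|vec_mx r i j - A i j|).
  by apply/funext => ?; rewrite !mxE.
have h : vec_mx t i j - A i j @[t --> r] --> vec_mx r i j - A i j.
  have c := @vec_mx_coord_cont i j r.
  exact: (cvgB c (cvg_cst _)).
exact: cvg_norm h.
Qed.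

Lemma l1_dist_attained A P : P !=set0 ->
  closed [set r : 'rV[R]_(m * n) | P (vec_mx r)] ->
  exists2 M, P M & forall N, P N -> l1norm (M - A) <= l1norm (N - A).
Proof.
move=> [M0 PM0] Pc; pose b := l1norm (M0 - A).
pose K := [set r | P (vec_mx r)] `&` [set r | l1norm (vec_mx r - A) <= b].
have Kc : closed K.
  apply: closedI => //.
  have /continuous_closedP := @l1norm_cont A.
  by move=> /(_ _ (@closed_le _ b)).
have Kb : bounded_set K.
  exists (b + l1norm A); split; first exact: num_real.
  move=> x bx r [_ /= rb]; apply: (le_trans _ (ltW bx)).
  rewrite /Num.norm/= mx_normrE; apply: bigmax_le => [|[i j] _ /=].
    by rewrite addr_ge0// l1norm_ge0.
  rewrite ord1; case/mxvec_indexP: j => a c.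
  rewrite (_ : r _ _ = vec_mx r a c); last by rewrite mxE.
  apply: (le_trans (ler_l1norm _ _ _)); rewrite -{1}[vec_mx r](subrK A).
  by apply: (le_trans (l1normD _ _)); rewrite lerD2r.
have K0 : K !=set0 by exists (mxvec M0); split => /=; rewrite mxvecK.
have [r Kr rmin] : exists2 r, r \in K &
    forall t, t \in K -> l1norm (vec_mx r - A) <= l1norm (vec_mx t - A).
  apply: EVT_min_rV => //; first exact: bounded_closed_compact.
  by apply: continuous_subspaceT; exact: l1norm_cont.
move: Kr; rewrite inE => -[Pr rb]; exists (vec_mx r) => // N PN.
have [Nb|/ltW Nb] := leP (l1norm (N - A)) b; last exact: le_trans Nb.
by have := rmin (mxvec N); rewrite mxvecK; apply; rewrite inE; split => /=;
  rewrite mxvecK.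
Qed.

Lemma mulmx_coord_cont (T : topologicalType) p (F : T -> 'M[R]_(m, n))
    (Q : 'M[R]_(n, p)) : (forall i j, continuous (fun t => F t i j)) ->
  forall i j, continuous (fun t => (F t *m Q) i j).
Proof.
move=> Fc i j; under eq_fun do rewrite mxE.
apply: continuous_big => [|l _] t; first exact: add_continuous.
by apply: cvgM; [exact: Fc|exact: cvg_cst].
Qed.

End Rows.

Lemma det_cont (T : topologicalType) p (F : T -> 'M[R]_p) :
  (forall i j, continuous (fun t => F t i j)) ->
  continuous (fun t => \det (F t)).
Proof.
move=> Fc; apply: continuous_big => [|s _] t; first exact: add_continuous.
apply: cvgM; first exact: cvg_cst.
move: t; apply: continuous_big => [|i _]; first exact: mul_continuous.
exact: Fc.
Qed.

Lemma closed_eq0 (T : topologicalType) (f : T -> R) : continuous f ->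
  closed [set t | f t = 0].
Proof.
by move=> /continuous_closedP /(_ _ (@closed_eq _ (0 : R))).
Qed.

Lemma rank_leP m n k (M : 'M[R]_(m, n)) : (\rank M <= k)%N <->
  forall (P : 'M[R]_(k.+1, m)) (Q : 'M[R]_(n, k.+1)), \det (P *m M *m Q) = 0.
Proof.
split=> [Mk P Q|MPQ].
  apply/eqP; apply/negPn; rewrite -unitfE -[_ \in _]/(_ \in unitmx).
  rewrite -row_free_unit /row_free; apply/eqP => rk.
  have := leq_trans (mxrankM_maxl _ Q) (mxrankM_maxr P M).
  by rewrite rk leqNgt ltnS Mk.
rewrite leqNgt; apply/negP => kM.
have := MPQ (pid_mx k.+1 *m invmx (col_ebase M))
            (invmx (row_ebase M) *m pid_mx k.+1).
rewrite -{2}(mulmx_ebase M) !mulmxA mulmxKV ?col_ebase_unit//.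
rewrite mulmxK ?row_ebase_unit// !mul_pid_mx (minn_idPl kM).
rewrite (minn_idPr (leq_trans kM (rank_leq_row M))) minnn.
rewrite (minn_idPr (leq_trans kM (rank_leq_col M))).
by rewrite pid_mx_1 det1 => /eqP; rewrite oner_eq0.
Qed.

Lemma closed_rank_le m n k :
  closed [set r : 'rV[R]_(m * n) | (\rank (vec_mx r : 'M[R]_(m, n)) <= k)%N].
Proof.
rewrite (_ : [set _ | _] =
  \bigcap_(PQ in [set: 'M[R]_(k.+1, m) * 'M[R]_(n, k.+1)])
  [set r | \det (PQ.1 *m vec_mx r *m PQ.2) = 0]).
  apply: closed_bigI => -[P Q] _; apply: closed_eq0; apply: det_cont.
  apply: mulmx_coord_cont => i j.
  rewrite (_ : (fun _ => _) =
    fun r : 'rV[R]_(m * n) => ((vec_mx r)^T *m P^T) j i).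
    apply: mulmx_coord_cont => a b.
    by under eq_fun do rewrite mxE; exact: vec_mx_coord_cont.
  by apply/funext => r; rewrite -trmx_mul [RHS]mxE.
apply/seteqP; split => r /=; first by move/rank_leP => h [P Q] _ /=.
by move=> h; apply/rank_leP => P Q; exact: (h (P, Q)).
Qed.

Lemma outerP m n (x : 'cV[R]_m) (M : 'M[R]_(m, n)) :
  (exists v : 'cV[R]_n, M = x *m v^T) <-> M^T *m cokermx x^T = 0.
Proof.
split=> [[v ->]|/eqP].
  by rewrite trmx_mul trmxK -mulmxA mulmx_coker mulmx0.
rewrite -submxE => /submxP[v Mv].
by exists v; rewrite -[M]trmxK Mv trmx_mul trmxK.
Qed.

Lemma rank1P m n (M : 'M[R]_(m, n)) : (\rank M <= 1)%N <->
  exists (u : 'cV[R]_m) (v : 'cV[R]_n), M = u *m v^T.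
Proof.
split=> [|[u [v ->]]]; last first.
  exact: leq_trans (mxrankM_maxl _ _) (rank_leq_col _).
rewrite leq_eqVlt ltnS leqn0 mxrank_eq0 => /orP[/eqP r1|/eqP ->]; last first.
  by exists 0, 0; rewrite mul0mx.
have := mulmx_base M; move: (col_base M) (row_base M); rewrite r1 => u w uw.
by exists u, w^T; rewrite trmxK.
Qed.

Lemma closed_outer m n (x : 'cV[R]_m) :
  closed [set r : 'rV[R]_(m * n) | exists v : 'cV[R]_n, vec_mx r = x *m v^T].
Proof.
rewrite (_ : [set _ | _] = \bigcap_(ij in [set: 'I_n * 'I_m])
  [set r : 'rV[R]_(m * n) | ((vec_mx r)^T *m cokermx x^T) ij.1 ij.2 = 0]).
  apply: closed_bigI => -[i j] _; apply: closed_eq0.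
  apply: mulmx_coord_cont => a b.
  by under eq_fun do rewrite mxE; exact: vec_mx_coord_cont.
apply/seteqP; split => r /=.
  by move=> /outerP h [i j] _ /=; rewrite h mxE.
by move=> h; apply/outerP/matrixP => i j; rewrite (h (i, j))// mxE.
Qed.

Lemma min_rankP m n k (A : 'M[R]_(m, n)) :
  let S := [set l1norm (A' - A) | A' in [set A' | (\rank A' <= k)%N]] in
  is_minimum S (minimum S).
Proof.
move=> S; apply: minimumP.
have [||M Mk Mmin] := @l1_dist_attained m n A [set A' | (\rank A' <= k)%N].
- by exists 0; rewrite /= mxrank0.
- exact: closed_rank_le.
exists (l1norm (M - A)); split; first by exists M.
by move=> _ [N Nk <-]; exact: Mmin.
Qed.

Lemma min_outerP m n (x : 'cV[R]_m) (A : 'M[R]_(m, n)) :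
  let S := [set l1norm (x *m v^T - A) | v in [set: 'cV[R]_n]] in
  is_minimum S (minimum S).
Proof.
move=> S; apply: minimumP.
have [||_ [v ->] Mmin] :=
  @l1_dist_attained m n A [set M | exists v : 'cV[R]_n, M = x *m v^T].
- by exists (x *m 0^T), 0.
- exact: closed_outer.
exists (l1norm (x *m v^T - A)); split; first by exists v.
by move=> _ [w _ <-]; apply: Mmin; exists w.
Qed.

Lemma min_rank1P m n (A : 'M[R]_(m, n)) :
  let S := [set l1norm (u *m v^T - A) |
             u in [set: 'cV[R]_m] & v in [set: 'cV[R]_n]] in
  is_minimum S (minimum S).
Proof.
move=> S; apply: minimumP.
have [||M /rank1P[u [v ->]] Mmin] :=
  @l1_dist_attained m n A [set A' | (\rank A' <= 1)%N].
- by exists 0; rewrite /= mxrank0.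
- exact: closed_rank_le.
exists (l1norm (u *m v^T - A)); split; first by exists u => //; exists v.
move=> _ [u' _ [v' _ <-]]; apply: Mmin; apply/rank1P.
by exists u', v'.
Qed.

End Attainment.

(* Main.v *)
Require Import Defs.
From mathcomp Require Import all_boot all_order all_algebra.
From mathcomp Require Import all_classical all_reals all_analysis.
From mathcomp Require Import lra.
Set Implicit Arguments.
Unset Strict Implicit.
Unset Printing Implicit Defensive.
Import Order.TTheory GRing.Theory Num.Theory.
Local Open Scope classical_set_scope.
Local Open Scope ring_scope.

(** The padded matrix is within [OPT1], the rank-one optimum for [A], of a
    rank-[k] matrix, so [Ahat = block_mx P Q S D] is within [C * OPT1] of the
    padded matrix. As [C * OPT1 <= E := n^(c1 + c3 + 2)] is far below [B], the
    corner [D = B%:M + error] is invertible, and the Schur complement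
    [N := P - Q D^-1 S] has rank at most one and differs from [P] by at most
    [E^2 / (B - E)]. If [N = x y^T] and [|y_j|] is maximal, then scaling column
    [j] of [P] by [y / y_j], whose entries are at most one, recovers [P] up to
    [(n + 1) E^2 / (B - E) <= n^(-c2)]. *)

Section EntrywiseL1.
Variable R : realType.

Lemma l1norm0 m n : l1norm (0 : 'M[R]_(m, n)) = 0.
Proof.
by rewrite /l1norm big1// => i _; rewrite big1// => j _; rewrite mxE normr0.
Qed.

Lemma l1norm_eq0 m n (M : 'M[R]_(m, n)) : l1norm M = 0 -> M = 0.
Proof.
move=> M0; apply/matrixP => i j; apply/eqP; rewrite mxE -normr_le0 -M0.
exact: ler_l1norm.
Qed.

Lemma l1normN m n (M : 'M[R]_(m, n)) : l1norm (- M) = l1norm M.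
Proof.
by apply: eq_bigr => i _; apply: eq_bigr => j _; rewrite mxE normrN.
Qed.

Lemma l1normZ m n (a : R) (M : 'M[R]_(m, n)) :
  l1norm (a *: M) = `|a| * l1norm M.
Proof.
rewrite /l1norm mulr_sumr; apply: eq_bigr => i _.
by rewrite mulr_sumr; apply: eq_bigr => j _; rewrite mxE normrM.
Qed.

Lemma l1norm_le_const m n (M : 'M[R]_(m, n)) (a : R) :
  (forall i j, `|M i j| <= a) -> l1norm M <= (m * n)%:R * a.
Proof.
move=> Ma; apply: (@le_trans _ _ (\sum_(i < m) \sum_(j < n) a)).
  by apply: ler_sum => i _; apply: ler_sum.
by rewrite !sumr_const !card_ord -mulrnA mulr_natl mulnC.
Qed.

Lemma l1norm_mulmx m n p (M : 'M[R]_(m, n)) (N : 'M[R]_(n, p)) :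
  l1norm (M *m N) <= l1norm M * l1norm N.
Proof.
rewrite {1 2}/l1norm mulr_suml; apply: ler_sum => i _.
apply: (@le_trans _ _ (\sum_(j < p) \sum_(l < n) `|M i l| * `|N l j|)).
  apply: ler_sum => j _; rewrite mxE; apply: le_trans (ler_norm_sum _ _ _) _.
  by apply: ler_sum => l _; rewrite normrM.
rewrite exchange_big mulr_suml; apply: ler_sum => l _ /=.
rewrite -mulr_sumr ler_wpM2l// /l1norm (bigD1 l)//= lerDl.
by apply: sumr_ge0 => *; apply: sumr_ge0.
Qed.

Lemma l1norm_block m1 m2 n1 n2 (P : 'M[R]_(m1, n1)) (Q : 'M[R]_(m1, n2))
    (S : 'M[R]_(m2, n1)) (D : 'M[R]_(m2, n2)) :
  l1norm (block_mx P Q S D) = l1norm P + l1norm Q + (l1norm S + l1norm D).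
Proof.
rewrite /l1norm big_split_ord/= -!big_split/=; congr (_ + _).
  apply: eq_bigr => i _; rewrite big_split_ord/=.
  by congr (_ + _); apply: eq_bigr => j _; rewrite ?block_mxEul ?block_mxEur.
apply: eq_bigr => i _; rewrite big_split_ord/=.
by congr (_ + _); apply: eq_bigr => j _; rewrite ?block_mxEdl ?block_mxEdr.
Qed.

Lemma l1norm_col m n (M : 'M[R]_(m, n)) j : l1norm (col j M) <= l1norm M.
Proof.
apply: ler_sum => i _; rewrite big_ord1 mxE (bigD1 j)//= lerDl.
exact: sumr_ge0.
Qed.

(** Triangle inequality on [b *: X = X *m D - X *m (D - b%:M)], with submultiplicativity for the
    last product. It serves twice: with [X] the kernel of [D] it gives invertibility, and with
    [X = Q D^-1] it bounds [X] by [Q]. *)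
Lemma l1norm_mulmx_perturbed_scalar m n (X : 'M[R]_(m, n)) (D : 'M[R]_n)
    (b : R) : 0 <= b ->
  (b - l1norm (D - b%:M)) * l1norm X <= l1norm (X *m D).
Proof.
move=> b0; rewrite mulrBl lerBlDr -{1}(ger0_norm b0) -l1normZ -mul_mx_scalar.
rewrite [_ * l1norm X]mulrC -[in leLHS](subKr D b%:M) mulmxBr.
apply: le_trans (l1normD _ _) _; rewrite lerD2l l1normN.
exact: l1norm_mulmx.
Qed.

Lemma perturbed_scalar_unitmx n (D : 'M[R]_n) (b : R) : 0 <= b ->
  l1norm (D - b%:M) < b -> D \in unitmx.
Proof.
move=> b0 Db; rewrite -row_free_unit -kermx_eq0; apply/eqP/l1norm_eq0.
have := @l1norm_mulmx_perturbed_scalar _ _ (kermx D) D b b0.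
rewrite mulmx_ker l1norm0 pmulr_rle0 ?subr_gt0// => le0; apply/eqP.
by rewrite eq_le le0 l1norm_ge0.
Qed.

(** Column [j] of [N] times a suitable [v^T] is exactly [N]. Putting column [j] of [P] in its place
    costs [col j (P - N) *m v^T], and choosing [j] with the largest coefficient keeps the entries of
    [v] at most 1. *)
Lemma rank1_col_approx m n (A P N : 'M[R]_(m, n)) : (0 < n)%N ->
  (\rank N <= 1)%N ->
  exists (j : 'I_n) (v : 'cV[R]_n),
    l1norm (col j P *m v^T - A) <= l1norm (P - A) + n.+1%:R * l1norm (P - N).
Proof.
move=> n0 /rank1P[x [y Nxy]].
pose j := [arg max_(i > Ordinal n0) `|y i 0|]%O.
have ymax i : `|y i 0| <= `|y j 0|.
  by rewrite /j; case: Order.TotalTheory.arg_maxP => // a _; apply.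
pose v : 'cV[R]_n := (y j 0)^-1 *: y.
have v1 i l : `|v i l| <= 1.
  rewrite ord1 mxE normrM normfV.
  have [->|yj0] := eqVneq (y j 0) 0; first by rewrite normr0 invr0 mul0r ler01.
  by rewrite mulrC ler_pdivrMr ?normr_gt0// mul1r.
(* If the maximal coefficient [y j 0] vanishes, then so does all of [y], hence [N = 0], and the
   convention [0^-1 = 0] in [v] is harmless. *)
have colN : col j N *m v^T = N.
  apply/matrixP => a b; rewrite Nxy !(mxE, big_ord1).
  have [yj0|yj0] := eqVneq (y j 0) 0; last by rewrite mulrA mulfK.
  suff -> : y b 0 = 0 by rewrite !mulr0.
  by apply/eqP; rewrite -normr_le0 (le_trans (ymax b))// yj0 normr0.
exists j, v.
have -> : col j P *m v^T - A = (P - A) + (- (P - N) + col j (P - N) *m v^T).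
  rewrite (_ : col j (P - N) = col j P - col j N); last first.
    by apply/matrixP => a b; rewrite !mxE.
  rewrite mulmxBl colN; move: (col j P *m v^T) => M.
  apply/matrixP => a b; rewrite !mxE; lra.
apply: le_trans (l1normD _ _) _; rewrite lerD2l.
apply: le_trans (l1normD _ _) _.
(* The factor [n.+1] splits as 1 for the term [P - N] and [n] for the norm of [v], which has [n]
   entries bounded by 1. *)
rewrite l1normN -natr1 mulrDl mul1r addrC lerD2r.
apply: le_trans (l1norm_mulmx _ _) _; rewrite mulrC.
apply: ler_pM (l1norm_col _ _); rewrite ?l1norm_ge0//.
apply: le_trans (@l1norm_le_const _ _ _ 1 _) _; last by rewrite mulr1 mul1n.
by move=> a b; rewrite mxE.
Qed.

End EntrywiseL1.

(** Block elimination by the unitriangular [L] and [T] leaves the Schur complement and [D] on the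
    diagonal. Multiplication cannot raise the rank, and [D] contributes its full rank [p]. *)
Lemma rank_schur (F : fieldType) m n p (P : 'M[F]_(m, n)) (Q : 'M[F]_(m, p))
    (S : 'M[F]_(p, n)) (D : 'M[F]_p) : D \in unitmx ->
  (\rank (P - Q *m invmx D *m S)%R + p <= \rank (block_mx P Q S D))%N.
Proof.
move=> Du; pose L : 'M[F]_(m + p) := block_mx 1%:M (- (Q *m invmx D)) 0 1%:M.
pose T : 'M[F]_(n + p) := block_mx 1%:M 0 (- (invmx D *m S)) 1%:M.
have : L *m block_mx P Q S D *m T = block_mx (P - Q *m invmx D *m S) 0 0 D.
  rewrite !mulmx_block !mul1mx !mul0mx !mulmx1 !mulmx0 !add0r.
  rewrite !mulNmx !mulmxN mulmxKV// subrr mul0mx oppr0 addr0 mulmxA.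
  by rewrite mulmxV// mul1mx subrr.
move=> eqLT; rewrite -[X in (_ + X)%N](mxrank_unit Du) -rank_diag_block_mx -eqLT.
exact: leq_trans (mxrankM_maxl _ _) (mxrankM_maxr _ _).
Qed.

Section Padded.
Variable R : realType.

(** The competitor keeps the blocks [B] exactly and replaces [A] by its best [u *m v^T], so its rank
    is at most [1 + (k - 1)]. *)
Lemma min_padded_le n k (A : 'M[R]_n) (B : R) : (1 <= k)%N ->
  minimum [set l1norm (A' - padded k A B) |
    A' in [set A' : 'M[R]_(n + (k - 1)) | (\rank A' <= k)%N]] <=
  minimum [set l1norm (u *m v^T - A) |
    u in [set: 'cV[R]_n] & v in [set: 'cV[R]_n]].
Proof.
move=> k1; have [[u _ [v _ <-]] _] := min_rank1P A.
have [_ lb] := min_rankP k (padded k A B).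
apply: lb; exists (block_mx (u *m v^T) 0 0 B%:M) => /=.
  rewrite rank_diag_block_mx -[leqRHS](subnKC k1).
  rewrite leq_add ?rank_leq_row//.
  exact: leq_trans (mxrankM_maxl _ _) (rank_leq_col _).
rewrite /padded opp_block_mx add_block_mx !subrr !l1norm_block.
by rewrite !l1norm0 !addr0.
Qed.

(** The main term is the true distance from [M] to the padded matrix; the cruder bound [E] enters
    only the error term. This is what preserves the factor [C] in the theorem. *)
Lemma padded_col_approx n k (A : 'M[R]_n) (B E : R)
    (M : 'M[R]_(n + (k - 1))) : (0 < n)%N -> (1 <= k)%N -> (\rank M <= k)%N ->
  0 <= E -> E < B -> l1norm (M - padded k A B) <= E ->
  exists (j : 'I_n) (v : 'cV[R]_n),
    l1norm (top_col M j *m v^T - A) <=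
      l1norm (M - padded k A B) + n.+1%:R * (E ^+ 2 / (B - E)).
Proof.
move=> n0 k1; rewrite -[M]submxK.
move: (ulsubmx M) (ursubmx M) (dlsubmx M) (drsubmx M) => P Q S D Mk E0 EB.
rewrite /padded opp_block_mx add_block_mx !subr0 l1norm_block => ME.
have [[[P0 Q0] S0] D0] := (l1norm_ge0 (P - A), l1norm_ge0 Q, l1norm_ge0 S,
  l1norm_ge0 (D - B%:M)).
have B0 : 0 <= B by lra.
have Du : D \in unitmx by apply: (perturbed_scalar_unitmx B0); lra.
pose X := Q *m invmx D.
have XE : l1norm X <= E / (B - E).
  rewrite ler_pdivlMr ?subr_gt0// mulrC.
  have := l1norm_mulmx_perturbed_scalar X D B0; rewrite mulmxKV// => XQ.
  apply: (@le_trans _ _ ((B - l1norm (D - B%:M)) * l1norm X)); last by lra.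
  by apply: ler_wpM2r; [exact: l1norm_ge0|lra].
(* The corner [D] uses up [k - 1] of the at most [k] dimensions of rank. *)
have Nr : (\rank (P - X *m S)%R <= 1)%N.
  have := leq_trans (rank_schur P Q S Du) Mk.
  by rewrite -[leqRHS](subnKC k1) leq_add2r.
have [j [v jv]] := rank1_col_approx A P n0 Nr.
exists j, v; rewrite (_ : top_col _ j = col j P); last first.
  by apply/matrixP => a b; rewrite mxE mxE block_mxEul mxE.
apply: le_trans jv _; apply: lerD; first by lra.
rewrite ler_wpM2l// subKr; apply: le_trans (l1norm_mulmx _ _) _.
have -> : E ^+ 2 / (B - E) = E / (B - E) * E by rewrite expr2 mulrAC.
by apply: ler_pM; rewrite ?l1norm_ge0//; lra.
Qed.

End Padded.

(** With [x = n >= 2], the gap [a + 1 <= d] gives [x^d - x^a >= x^d / 2]. It remains to see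
    [2 (x + 1) x^(2a + c) <= x^d], where [2 (x + 1) <= x^3] accounts for the 3 in the exponent. *)
Lemma powR_schur_error (R : realType) (n : nat) (a c d : R) : (2 <= n)%N ->
  0 <= c -> a + 1 <= d -> 2 * a + c + 3 <= d ->
  n%:R `^ a < n%:R `^ d /\
  n.+1%:R * ((n%:R `^ a) ^+ 2 / (n%:R `^ d - n%:R `^ a)) <= 1 / n%:R `^ c.
Proof.
move=> n2 c0 ad acd; pose x : R := n%:R.
have x2 : 2 <= x by rewrite /x ler_nat.
have x0 : 0 < x by lra.
have x1 : 1 <= x by lra.
have xa0 : 0 < x `^ a by exact: powR_gt0.
have xd0 : 0 < x `^ d by exact: powR_gt0.
have xD r s : x `^ (r + s) = x `^ r * x `^ s by rewrite powRD// (gt_eqF x0) implybT.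
have had : 2 * x `^ a <= x `^ d.
  apply: (@le_trans _ _ (x `^ (a + 1))); last exact: ler_powR.
  by rewrite xD powRr1 ?(ltW x0)// mulrC ler_pM2l.
split; first by rewrite -/x; lra.
rewrite -/x mulrA ler_pdivrMr; last by lra.
rewrite mul1r [leRHS]mulrC ler_pdivlMr ?powR_gt0// -natr1 -/x.
apply: (@le_trans _ _ (x `^ d / 2)); last by lra.
rewrite ler_pdivlMr//.
apply: (@le_trans _ _ (x `^ (2 * a + c + 3))); last exact: ler_powR.
have -> : x `^ (2 * a + c + 3) = x ^+ 3 * (x `^ a ^+ 2 * x `^ c).
  rewrite (xD (2 * a + c)) (xD (2 * a)) powR_mulrn ?(ltW x0)// mulr_natl mulr2n xD expr2.
  by rewrite [RHS]mulrC.
have -> : (x + 1) * x `^ a ^+ 2 * x `^ c * 2 =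
  2 * (x + 1) * (x `^ a ^+ 2 * x `^ c) by lra.
apply: ler_wpM2r; last by nra.
by rewrite mulr_ge0// ?exprn_ge0 ?powR_ge0.
Qed.

Theorem theoremH18 (R : realType) (c1 c2 c3 c4 : R)
  (hc1 : 0 < c1) (hc2 : 0 < c2) (hc3 : 0 < c3)
  (hc4 : 10 * (c1 + c2 + c3 + 1) <= c4)
  (n k : nat) (hn : (1 <= n)%N) (hk : (1 <= k)%N)
  (A : 'M[R]_n) (hA : forall i j, `|A i j| <= n%:R `^ c1)
  (Ahat : 'M[R]_(n + (k - 1))) (hrank : (\rank Ahat <= k)%N)
  (C : R) (hC : 1 <= C <= n%:R `^ c3)
  (happrox : let Atilde := padded k A (n%:R `^ c4) in
     l1norm (Ahat - Atilde) <=
       C * minimum [set l1norm (A' - Atilde) |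
                     A' in [set A' : 'M[R]_(n + (k - 1)) | (\rank A' <= k)%N]]) :
  exists j : 'I_n,
    minimum [set l1norm (top_col Ahat j *m v^T - A) | v in [set: 'cV[R]_n]] <=
      C * minimum [set l1norm (u *m v^T - A) |
                    u in [set: 'cV[R]_n] & v in [set: 'cV[R]_n]]
      + 1 / n%:R `^ c2.
Proof.
have /andP[C1 Cn] := hC; have C0 : 0 <= C by lra.
set O1 := minimum [set l1norm (u *m v^T - A) |
                    u in [set: 'cV[R]_n] & v in [set: 'cV[R]_n]].
have AhatO1 : l1norm (Ahat - padded k A (n%:R `^ c4)) <= C * O1.
  by apply: le_trans happrox _; apply: ler_wpM2l => //; exact: min_padded_le.
have normA : l1norm A <= (n * n)%:R * n%:R `^ c1 by exact: l1norm_le_const.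
have [[u _ [v _ O1E]] O1min] := min_rank1P A.
have O10 : 0 <= O1 by rewrite /O1 -O1E l1norm_ge0.
have O1A : O1 <= l1norm A.
  (* The zero matrix is a rank-one competitor. *)
  by apply: O1min; exists 0 => //; exists 0 => //; rewrite mul0mx sub0r l1normN.
have [n2|n1] := leqP 2 n; last first.
  (* For n = 1 the padding B is only 1, but the additive slack is also 1. *)
  exists (Ordinal hn); have [_ lb] := min_outerP (top_col Ahat (Ordinal hn)) A.
  apply: (@le_trans _ _ (l1norm A)).
    by apply: lb; exists 0 => //; rewrite trmx0 mulmx0 sub0r l1normN.
  have nE : n%:R = 1 :> R.
    by apply/eqP; rewrite pnatr_eq1 eqn_leq hn -ltnS n1.
  move: normA; rewrite natrM nE !powR1 => normA.
  by have := mulr_ge0 C0 O10; lra.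
(* The optimum is at most the norm of [A], hence at most [n^(c1 + 2)], and [C] is at most [n^c3].
   The exponent condition then reads [2 c1 + 2 c3 + c2 + 7 <= c4]. *)
pose a := c1 + c3 + 2.
have [EB err] : n%:R `^ a < n%:R `^ c4 /\
    n.+1%:R * ((n%:R `^ a) ^+ 2 / (n%:R `^ c4 - n%:R `^ a)) <= 1 / n%:R `^ c2.
  by apply: powR_schur_error => //; rewrite /a; lra.
have O1a : C * O1 <= n%:R `^ a.
  have nD r s : n%:R `^ (r + s) = n%:R `^ r * n%:R `^ s :> R.
    by rewrite powRD// pnatr_eq0 -lt0n hn implybT.
  rewrite /a (nD (c1 + c3)) nD powR_mulrn// mulrAC [leLHS]mulrC.
  apply: ler_pM => //.
  by apply: le_trans O1A _; rewrite mulrC expr2 -natrM.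
have [j [w jw]] := padded_col_approx hn hk hrank (powR_ge0 _ _) EB
  (le_trans AhatO1 O1a).
exists j; have [_ lb] := min_outerP (top_col Ahat j) A.
apply: le_trans (lerD AhatO1 err); apply: le_trans jw.
by apply: lb; exists w.
Qed.
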